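(* Let $f$ satisfy (f1) and suppose $f_0=+\infty$ and $f_\infty=+\infty$. Then there exists $\lambda^+>0$ such that for every $\lambda\in(0,\lambda^+)$ problem (MO) has two solutions $u_1^+,u_2^+$ which are positive and strictly concave in $(0,1)$. Similarly, there exists $\lambda^->0$ such that for every $\lambda\in(0,\lambda^-)$ problem (MO) has two solutions $u_1^-,u_2^-$ which are negative and strictly convex in $(0,1)$.
   Context: Let $N\ge 1$ be an integer and $f:\mathbb{R}\to\mathbb{R}$ continuous. For $\lambda\ge 0$, problem (MO) is: find $u\in C^2[0,1]$ with $\left((u'(r))^N\right)'=\lambda^N N r^{N-1} f(-u(r))$ for $0<r<1$ and $u'(0)=u(1)=0$. Condition (f1): $f\in C(\mathbb{R},\mathbb{R})$ and $f(s)s^N>0$ for all $s\neq0$. The quantities $f_0,f_\infty\in[0,+\infty]$ are defined by $f_0^N=\lim_{s\to0} f(s)/s^N$ and $f_\infty^N=\lim_{|s|\to+\infty} f(s)/s^N$ (limits assumed to exist in $[0,+\infty]$). *)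

(* Defs.v *)
From Stdlib Require Import Reals Lra.
Open Scope R_scope.

Definition cond_f1 (N : nat) (f : R -> R) : Prop :=
  continuity f /\ forall s, s <> 0 -> f s * s ^ N > 0.

Definition f0_is_infty (N : nat) (f : R -> R) : Prop :=
  forall M : R, exists delta : R, delta > 0 /\
    forall s, s <> 0 -> Rabs s < delta -> f s / s ^ N > M.

Definition finf_is_infty (N : nat) (f : R -> R) : Prop :=
  forall M : R, exists K : R,
    forall s, Rabs s > K -> f s / s ^ N > M.

Definition MO_solution (N : nat) (f : R -> R) (lam : R) (u : R -> R) : Prop :=
  exists du ddu : R -> R,
    (forall x, derivable_pt_lim u x (du x)) /\
    (forall x, derivable_pt_lim du x (ddu x)) /\
    continuity ddu /\
    (forall r, 0 < r < 1 ->
       derivable_pt_lim (fun t => (du t) ^ N) r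
         (lam ^ N * INR N * r ^ (N - 1) * f (- u r))) /\
    du 0 = 0 /\ u 1 = 0.

Definition strictly_concave_on_01 (u : R -> R) : Prop :=
  forall x y t, 0 < x < 1 -> 0 < y < 1 -> x <> y -> 0 < t < 1 ->
    u (t * x + (1 - t) * y) > t * u x + (1 - t) * u y.

Definition strictly_convex_on_01 (u : R -> R) : Prop :=
  forall x y t, 0 < x < 1 -> 0 < y < 1 -> x <> y -> 0 < t < 1 ->
    u (t * x + (1 - t) * y) < t * u x + (1 - t) * u y.

(* Main.v *)
Require Import Defs.
From Stdlib Require Import Reals ZArith Lra Lia Classical ClassicalEpsilon.
From Coquelicot Require Import Coquelicot.
From mathcomp Require filter.
Open Scope R_scope.

(** Both signs reduce to one problem for [v > 0], namely
    [((- v')^N)' = c^N N r^(N-1) g(v)], with [g s = (-1)^N f(-s)] and [u = v], or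
    [g = f] and [u = - v].  It is solved by shooting from [v 0 = a].  Since [g] is only
    continuous, the initial value problem may have many solutions; so one shoots with
    an Euler scheme, whose endpoint depends continuously on [a], and then takes a
    pointwise limit along a free ultrafilter as the mesh tends to [0].
    Monotonicity of the slope gives increment inequalities for the scheme which pass
    to the limit and characterize the differential system.  Every limit solution has
    [v 1 > 0] if [a = 1] and [c] is small, and has [v 1 < 0] if [a] is small or large,
    because [g s / s^N] is then large; hence there are zeros of the endpoint map with
    [a < 1] and with [a > 1]. *)

(** * Free ultrafilters on [nat] and limits along them *)

(** The ultrafilter lemma is applied to the Frechet filter [eventually]. The two libraries have
    separate filter classes, so the laws are carried over by hand. *)
Lemma ex_free_ultrafilter : exists U : (nat -> Prop) -> Prop,
  ProperFilter U /\ (forall P, Hierarchy.eventually P -> U P) /\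
  (forall P : nat -> Prop, U P \/ U (fun n => ~ P n)).
Proof.
assert (HF : @filter.ProperFilter nat Hierarchy.eventually).
{ split.
  - intros [n0 Hn]. exact (Hn n0 (le_n _)).
  - split.
    + now exists 0%nat.
    + intros P Q HP HQ. now apply filter_and.
    + intros P Q HPQ HP. revert HP. now apply filter_imp. }
destruct (filter.ultraFilterLemma HF) as [U [HU HE]].
pose proof (filter.ultra_proper (F := U)) as HP.
destruct HP as [H0 [HT HI HS]].
exists U. split; [|split].
- split.
  + intros P HP. apply NNPP. intros Hn. apply H0. revert HP. apply HS.
    intros x Px. apply Hn. now exists x.
  + split.
    * exact HT.
    * intros P Q. apply HI.
    * intros P Q HPQ. now apply HS.
- exact HE.
- intros P. exact (filter.in_ultra_setVsetC P HU).
Qed.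

(** The limit is the supremum of the [y] with [y <= x n] for [U]-almost all [n]. If [x n] did not
    stay within [eps] of it, the ultrafilter dichotomy would put the opposite inequality in [U] and
    contradict the supremum. *)
Lemma ultrafilter_lim_bounded (U : (nat -> Prop) -> Prop) (FU : ProperFilter U)
  (HU : forall P : nat -> Prop, U P \/ U (fun n => ~ P n)) (x : nat -> R) (A B : R) :
  U (fun n => A <= x n <= B) -> exists l : R, filterlim x U (locally l).
Proof.
intros Hb.
destruct (completeness (fun y => U (fun n => y <= x n))) as [l [Hub Hlub]].
- exists B. intros y Hy.
  destruct (filter_ex _ (filter_and _ _ Hb Hy)) as [n [H1 H2]]. lra.
- exists A. revert Hb. apply filter_imp. intros n Hn. lra.
- exists l. apply filterlim_locally. intros eps.
  assert (H1 : U (fun n => l - eps < x n)).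
  { destruct (HU (fun n => l - eps < x n)) as [H|H]; [exact H|exfalso].
    pose proof (cond_pos eps).
    assert (l <= l - eps); [|lra]. apply Hlub. intros y Hy.
    destruct (filter_ex _ (filter_and _ _ H Hy)) as [n [H2 H3]]. lra. }
  assert (H2 : U (fun n => x n < l + eps)).
  { destruct (HU (fun n => x n < l + eps)) as [H|H]; [exact H|exfalso].
    pose proof (cond_pos eps).
    assert (l + eps <= l); [|lra]. apply Hub. revert H. apply filter_imp.
    intros n Hn. lra. }
  generalize (filter_and _ _ H1 H2). apply filter_imp. intros n [H3 H4].
  apply Rabs_def1; unfold minus, plus, opp; simpl; lra.
Qed.

Lemma filterlim_R_le {T} (F : (T -> Prop) -> Prop) (FF : ProperFilter F) (x y : T -> R) (a b : R) :
  F (fun t => x t <= y t) -> filterlim x F (locally a) -> filterlim y F (locally b) -> a <= b.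
Proof.
intros H Hx Hy.
exact (filterlim_le (F := F) x y (Finite a) (Finite b) H Hx Hy).
Qed.

Lemma filterlim_R_plus {T} (F : (T -> Prop) -> Prop) (FF : Filter F) (x y : T -> R) (a b : R) :
  filterlim x F (locally a) -> filterlim y F (locally b) ->
  filterlim (fun t => x t + y t) F (locally (a + b)).
Proof.
intros Hx Hy. 
eapply filterlim_comp_2; [exact Hx|exact Hy|]. exact (filterlim_plus (V := R_NormedModule) a b).
Qed.

Lemma filterlim_R_mult {T} (F : (T -> Prop) -> Prop) (FF : Filter F) (x y : T -> R) (a b : R) :
  filterlim x F (locally a) -> filterlim y F (locally b) ->
  filterlim (fun t => x t * y t) F (locally (a * b)).
Proof.
intros Hx Hy. 
eapply filterlim_comp_2; [exact Hx|exact Hy|]. exact (filterlim_mult (K := R_AbsRing) a b).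
Qed.

Lemma filterlim_R_continuous {T} (F : (T -> Prop) -> Prop) (FF : Filter F) (x : T -> R) (a : R) (phi : R -> R) :
  continuity_pt phi a -> filterlim x F (locally a) ->
  filterlim (fun t => phi (x t)) F (locally (phi a)).
Proof.
intros Hp Hx. apply (filterlim_comp _ _ _ x phi F _ _ Hx).
now apply continuity_pt_filterlim.
Qed.

(** * The [N]-th root, extended by zero to negative arguments *)

Section Root.
Variable N : nat.
Hypothesis HN : (1 <= N)%nat.

(** The case split matters at [0]: [ln 0] is [0] by default, so [Rpower 0 (/ INR N)] would be [1].
    The value [0] on the negative axis keeps the function monotone and continuous on the whole
    line. *)
Definition root (y : R) : R := if Rlt_dec 0 y then Rpower y (/ INR N) else 0.

Lemma root_pos y : 0 < y -> 0 < root y.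
Proof. intros H. unfold root. destruct (Rlt_dec 0 y); [apply exp_pos|lra]. Qed.

Lemma root_ge0 y : 0 <= root y.
Proof. unfold root. destruct (Rlt_dec 0 y); [left; apply exp_pos|lra]. Qed.

Lemma root_0 : root 0 = 0.
Proof. unfold root. destruct (Rlt_dec 0 0); lra. Qed.

Lemma INR_N_pos : 0 < INR N.
Proof. apply lt_0_INR. lia. Qed.

Lemma root_pow y : 0 <= y -> root y ^ N = y.
Proof.
intros H. unfold root. destruct (Rlt_dec 0 y) as [Hy|Hy].
- rewrite <- Rpower_pow by apply exp_pos.
  rewrite Rpower_mult, Rinv_l, Rpower_1; try lra.
  generalize INR_N_pos; lra.
- rewrite pow_i by lia. lra.
Qed.

Lemma pow_lt_compat x y : 0 <= x < y -> x ^ N < y ^ N.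
Proof.
intros H. destruct N as [|n]; [lia|]. clear HN.
induction n as [|n IH]; [simpl; lra|].
change (x * x ^ S n < y * y ^ S n).
pose proof (pow_le x (S n) (proj1 H)). nra.
Qed.

Lemma pow_le_cancel x y : 0 <= y -> x ^ N <= y ^ N -> x <= y.
Proof.
intros Hy H. destruct (Rle_lt_dec x y) as [h|h]; [exact h|].
pose proof (pow_lt_compat y x (conj Hy h)). lra.
Qed.

Lemma pow_root x : 0 <= x -> root (x ^ N) = x.
Proof.
intros H. pose proof (pow_le x N H). pose proof (root_ge0 (x ^ N)).
apply Rle_antisym; apply pow_le_cancel; try lra; rewrite root_pow; lra.
Qed.

Lemma root_le x y : x <= y -> root x <= root y.
Proof.
intros H. destruct (Rle_lt_dec x 0) as [h|h].
- unfold root at 1. destruct (Rlt_dec 0 x); [lra|apply root_ge0].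
- apply pow_le_cancel; [apply root_ge0|]. rewrite !root_pow; lra.
Qed.

Lemma root_lt x y : 0 <= x < y -> root x < root y.
Proof.
intros H. destruct (Rle_lt_dec (root y) (root x)) as [h|h]; [|exact h].
pose proof (pow_incr _ _ N (conj (root_ge0 y) h)). rewrite !root_pow in H0; lra.
Qed.

Lemma pow_superadditive x y : 0 <= x -> 0 <= y -> x ^ N + y ^ N <= (x + y) ^ N.
Proof.
intros Hx Hy. destruct N as [|n]; [lia|]. clear HN.
induction n as [|n IH]; [simpl; lra|].
change (x * x ^ S n + y * y ^ S n <= (x + y) * (x + y) ^ S n).
pose proof (pow_le x (S n) Hx). pose proof (pow_le y (S n) Hy). nra.
Qed.

(** For [x >= 0], [pow_superadditive] gives [(root x + e) ^ N >= x + e ^ N], so [e ^ N] is a modulus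
    of continuity that is uniform in [x]. *)
Lemma continuity_root : continuity root.
Proof.
assert (Hinc : forall x y e, 0 < e -> x <= y < x + e ^ N -> root x <= root y < root x + e).
{ intros x y e He H. split; [apply root_le; lra|].
  pose proof (pow_lt e N He).
  destruct (Rle_lt_dec y 0) as [h|h].
  - unfold root at 1. destruct (Rlt_dec 0 y); [lra|]. generalize (root_ge0 x); lra.
  - destruct (Rlt_le_dec (root y) (root x + e)) as [h'|h']; [exact h'|].
    pose proof (root_ge0 x).
    assert (H2 : (root x + e) ^ N <= root y ^ N) by (apply pow_incr; lra).
    pose proof (pow_superadditive (root x) e (root_ge0 x) (Rlt_le _ _ He)).
    rewrite root_pow in H2 by lra.
    destruct (Rle_lt_dec x 0) as [hx|hx].
    + pose proof (pow_le (root x) N (root_ge0 x)). lra.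
    + rewrite root_pow in H3 by lra. lra. }
intros x. apply continuity_pt_filterlim, filterlim_locally. intros e.
assert (He : 0 < e ^ N) by apply pow_lt, cond_pos.
exists (mkposreal _ He). intros y Hy.
apply Rabs_def2 in Hy. unfold minus, plus, opp in Hy; simpl in Hy.
apply Rabs_def1; unfold minus, plus, opp; simpl;
  destruct (Rle_lt_dec x y) as [h|h];
  first [pose proof (Hinc x y e (cond_pos e) ltac:(lra)) | pose proof (Hinc y x e (cond_pos e) ltac:(lra))];
  pose proof (cond_pos e); lra.
Qed.
End Root.

(** * An Euler scheme for the system in [v] and [y = (- v')^N] *)

Section Euler.
Variables (N : nat) (c : R) (g : R -> R).
Hypothesis HN : (1 <= N)%nat.
Hypothesis Hc : 0 < c.
Hypothesis g_cont : continuity g.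
Hypothesis g_ge0 : forall s, 0 <= g s.

(** The difference of [N]-th powers is the exact integral of [N r^(N-1)] over one step, with [g]
    frozen at the left node. It telescopes, so the increment bounds for the scheme carry no
    discretization error. *)
Fixpoint euler (h a : R) (k : nat) : R * R :=
  match k with
  | O => (a, 0)
  | S j =>
      let y := snd (euler h a j) +
        c ^ N * ((INR (S j) * h) ^ N - (INR j * h) ^ N) * g (fst (euler h a j)) in
      (fst (euler h a j) - h * root N y, y)
  end.

(** For fixed [h] and [k] the scheme is a finite composition of continuous maps. This is the
    continuous dependence on the initial value that the differential system itself may lack. *)
Lemma continuity_euler h k :
  continuity (fun a => fst (euler h a k)) /\ continuity (fun a => snd (euler h a k)).
Proof.
induction k as [|k [IH1 IH2]].
- split; cbn -[INR pow]; [apply derivable_continuous, derivable_id|now apply continuity_const].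
- assert (H2 : continuity (fun a => snd (euler h a (S k)))).
  { cbn -[INR pow]. apply (continuity_plus _ _ IH2).
    apply (continuity_scal (fun a => g (fst (euler h a k)))).
    exact (continuity_comp _ _ IH1 g_cont). }
  split; [|exact H2]. 
  apply (continuity_minus _ (fun a => h * root N (snd (euler h a (S k)))) IH1).
  apply (continuity_scal (fun a => root N (snd (euler h a (S k))))).
  exact (continuity_comp _ _ H2 (continuity_root N HN)).
Qed.

Lemma euler_step_pow_le h k : 0 <= h -> (INR k * h) ^ N <= (INR (S k) * h) ^ N.
Proof.
intros Hh. pose proof (pos_INR k). apply pow_incr. rewrite S_INR. nra.
Qed.

Lemma cN_pos : 0 < c ^ N.
Proof. now apply pow_lt. Qed.

Lemma euler_snd_S h a k : snd (euler h a (S k)) = snd (euler h a k) +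
  c ^ N * ((INR (S k) * h) ^ N - (INR k * h) ^ N) * g (fst (euler h a k)).
Proof. reflexivity. Qed.

Lemma euler_fst_S h a k :
  fst (euler h a (S k)) = fst (euler h a k) - h * root N (snd (euler h a (S k))).
Proof. reflexivity. Qed.

Lemma euler_snd_le h a j k : 0 <= h -> (j <= k)%nat -> snd (euler h a j) <= snd (euler h a k).
Proof.
intros Hh Hjk. induction Hjk as [|k Hjk IH]; [lra|].
rewrite euler_snd_S. pose proof (euler_step_pow_le h k Hh). pose proof cN_pos.
pose proof (g_ge0 (fst (euler h a k))).
assert (0 <= c ^ N * ((INR (S k) * h) ^ N - (INR k * h) ^ N)) by (apply Rmult_le_pos; lra).
pose proof (Rmult_le_pos _ _ H2 H1). lra.
Qed.

Lemma euler_snd_ge0 h a k : 0 <= h -> 0 <= snd (euler h a k).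
Proof. intros Hh. apply (euler_snd_le h a 0 k Hh). lia. Qed.

Lemma euler_fst_le h a j k : 0 <= h -> (j <= k)%nat -> fst (euler h a k) <= fst (euler h a j).
Proof.
intros Hh Hjk. induction Hjk as [|k Hjk IH]; [lra|].
rewrite euler_fst_S. pose proof (root_ge0 N (snd (euler h a (S k)))). nra.
Qed.

(** The slope [root N y] is nondecreasing along the scheme, so each step between [j] and [k] lowers
    [v] by [h] times a slope lying between the two end slopes. *)
Lemma euler_fst_bounds h a j k : 0 <= h -> (j <= k)%nat ->
  (INR k * h - INR j * h) * root N (snd (euler h a j)) <= fst (euler h a j) - fst (euler h a k)
  <= (INR k * h - INR j * h) * root N (snd (euler h a k)).
Proof.
intros Hh Hjk. induction Hjk as [|k Hjk IH]; [lra|].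
assert (H1 := root_le N HN _ _ (euler_snd_le h a j (S k) Hh ltac:(lia))).
assert (H2 := root_le N HN _ _ (euler_snd_le h a k (S k) Hh ltac:(lia))).
assert (H3 : INR j <= INR k) by (apply le_INR; lia).
rewrite euler_fst_S, S_INR.
set (x := root N (snd (euler h a j))) in *.
set (y := root N (snd (euler h a k))) in *.
set (z := root N (snd (euler h a (S k)))) in *.
assert (H4 : h * x <= h * z) by now apply Rmult_le_compat_l.
assert (H5 : (INR k * h - INR j * h) * y <= (INR k * h - INR j * h) * z).
{ apply Rmult_le_compat_l; [nra|exact H2]. }
nra.
Qed.

(** The first component is nonincreasing, so every value at which [g] is sampled lies between the
    two end values; the weights [(INR (S i) * h) ^ N - (INR i * h) ^ N] then telescope. *)
Lemma euler_snd_bounds h a j k m M : 0 <= h -> (j <= k)%nat ->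
  (forall x, fst (euler h a k) <= x <= fst (euler h a j) -> m <= g x <= M) ->
  c ^ N * ((INR k * h) ^ N - (INR j * h) ^ N) * m <= snd (euler h a k) - snd (euler h a j)
  <= c ^ N * ((INR k * h) ^ N - (INR j * h) ^ N) * M.
Proof.
intros Hh Hjk. induction Hjk as [|k Hjk IH]; intros Hg; [lra|].
assert (H1 := euler_fst_le h a k (S k) Hh ltac:(lia)).
assert (H2 := euler_fst_le h a j k Hh ltac:(lia)).
specialize (IH ltac:(intros; apply Hg; lra)).
specialize (Hg (fst (euler h a k)) ltac:(lra)).
rewrite euler_snd_S. pose proof (euler_step_pow_le h k Hh). pose proof cN_pos.
set (p := c ^ N * ((INR (S k) * h) ^ N - (INR k * h) ^ N)).
assert (Hp : 0 <= p) by (apply Rmult_le_pos; lra).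
replace (c ^ N * ((INR (S k) * h) ^ N - (INR j * h) ^ N)) with
  (c ^ N * ((INR k * h) ^ N - (INR j * h) ^ N) + p) by (unfold p; ring).
pose proof (Rmult_le_compat_l p _ _ Hp (proj1 Hg)).
pose proof (Rmult_le_compat_l p _ _ Hp (proj2 Hg)). lra.
Qed.

(** * Uniform grids of mesh [1 / (n + 1)] *)

Definition mesh (n : nat) : R := / INR (S n).
(* [Int_part] is the floor and [Z.to_nat] sends negative integers to [0], so [node n r = 0]
   for [r <= 0]. *)
Definition node (n : nat) (r : R) : nat := Z.to_nat (Int_part (r * INR (S n))).

Lemma mesh_pos n : 0 < mesh n.
Proof. apply Rinv_0_lt_compat, lt_0_INR. lia. Qed.

Lemma node_le n r s : r <= s -> (node n r <= node n s)%nat.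
Proof.
intros H. unfold node.
assert (H0 : 0 < INR (S n)) by (apply lt_0_INR; lia).
assert (Hm : r * INR (S n) <= s * INR (S n)) by (apply Rmult_le_compat_r; lra).
destruct (base_Int_part (r * INR (S n))) as [H1 H2].
destruct (base_Int_part (s * INR (S n))) as [H3 H4].
set (x := Int_part (r * INR (S n))) in *. set (y := Int_part (s * INR (S n))) in *.
assert (H5 : IZR x < IZR (y + 1)) by (rewrite plus_IZR; lra).
apply lt_IZR in H5. lia.
Qed.

Lemma node_nonpos n r : r <= 0 -> node n r = 0%nat.
Proof.
intros H. unfold node.
assert (H0 : 0 < INR (S n)) by (apply lt_0_INR; lia).
destruct (base_Int_part (r * INR (S n))) as [H1 H2].
assert (H3 : r * INR (S n) <= 0) by nra.
assert (H4 : IZR (Int_part (r * INR (S n))) <= IZR 0) by lra.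
apply le_IZR in H4. lia.
Qed.

Lemma node_bounds n r : Rmax r 0 - mesh n <= INR (node n r) * mesh n <= Rmax r 0.
Proof.
destruct (Rle_lt_dec r 0) as [h|h].
- rewrite (node_nonpos n r h). rewrite Rmax_right by lra. simpl. generalize (mesh_pos n); lra.
- rewrite Rmax_left by lra. unfold node, mesh.
  assert (H0 : 0 < INR (S n)) by (apply lt_0_INR; lia).
  destruct (base_Int_part (r * INR (S n))) as [H1 H2].
  set (x := Int_part (r * INR (S n))) in *.
  assert (H3 : 0 < r * INR (S n)) by nra.
  assert (Hx : (0 <= x)%Z).
  { assert (H4 : IZR (-1) < IZR x) by lra. apply lt_IZR in H4. lia. }
  rewrite (INR_IZR_INZ (Z.to_nat x)), Z2Nat.id by exact Hx.
  split; apply (Rmult_le_reg_r (INR (S n))); try lra; field_simplify; lra.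
Qed.

Lemma mesh_node_lim r :
  filterlim (fun n => INR (node n r) * mesh n) Hierarchy.eventually (locally (Rmax r 0)).
Proof.
assert (Hm : is_lim_seq mesh 0).
{ unfold mesh. apply (is_lim_seq_incr_1 (fun n => / INR n)).
  replace (Finite 0) with (Rbar_inv p_infty) by reflexivity.
  apply is_lim_seq_inv; [apply is_lim_seq_INR|discriminate]. }
apply (is_lim_seq_le_le (fun n => Rmax r 0 - mesh n) _ (fun n => Rmax r 0) (Rmax r 0)).
- intros n. apply node_bounds.
- replace (Finite (Rmax r 0)) with (Finite (Rmax r 0 - 0)) by (f_equal; ring).
  apply is_lim_seq_minus'; [apply is_lim_seq_const|exact Hm].
- apply is_lim_seq_const.
Qed.

(* [y] is [(- v')^N].  The system is recorded through inequalities between increments,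
   because these survive a pointwise limit; [Rmax _ 0] encodes the constant extension
   of [v] and [y] to negative arguments. *)
Record ivp_solution (a : R) (v y : R -> R) : Prop := {
  ivp_v_le0 : forall r, r <= 0 -> v r = a;
  ivp_y_le0 : forall r, r <= 0 -> y r = 0;
  ivp_y_le : forall r s, r <= s -> y r <= y s;
  ivp_v_bounds : forall r s, r <= s ->
    (Rmax s 0 - Rmax r 0) * root N (y r) <= v r - v s <= (Rmax s 0 - Rmax r 0) * root N (y s);
  ivp_y_bounds : forall r s m M e, r <= s -> 0 < e ->
    (forall x, v s - e <= x <= v r + e -> m <= g x <= M) ->
    c ^ N * (Rmax s 0 ^ N - Rmax r 0 ^ N) * m <= y s - y r <= c ^ N * (Rmax s 0 ^ N - Rmax r 0 ^ N) * M
}.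

(** * Passage to the limit along the ultrafilter *)

Section Limit.
Variable U : (nat -> Prop) -> Prop.
Hypothesis FU : ProperFilter U.
Hypothesis U_free : forall P, Hierarchy.eventually P -> U P.
Hypothesis U_ultra : forall P : nat -> Prop, U P \/ U (fun n => ~ P n).

Lemma mesh_node_ulim r : filterlim (fun n => INR (node n r) * mesh n) U (locally (Rmax r 0)).
Proof. intros P HP. apply U_free. exact (mesh_node_lim r P HP). Qed.

(** At each [r] both components are bounded for [U]-almost all [n], hence converge along [U]. One
    ultrafilter serves all real [r] at once, without extraction of subsequences, and the non-strict
    increment inequalities survive. *)
Lemma euler_limit (b : nat -> R) (A B G : R) :
  U (fun n => A <= b n <= B) -> (forall x, x <= B -> g x <= G) ->
  exists (a : R) (v y : R -> R),
    A <= a <= B /\ ivp_solution a v y /\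
    (forall r, filterlim (fun n => fst (euler (mesh n) (b n) (node n r))) U (locally (v r))).
Proof.
intros Hb HG.
destruct (ultrafilter_lim_bounded U FU U_ultra b A B Hb) as [a Ha].
assert (HaAB : A <= a <= B).
{ split.
  - refine (filterlim_R_le U FU (fun _ => A) b A a _ (filterlim_const A) Ha).
    revert Hb; apply filter_imp; tauto.
  - refine (filterlim_R_le U FU b (fun _ => B) a B _ Ha (filterlim_const B)).
    revert Hb; apply filter_imp; tauto. }
assert (Hm : forall n, 0 <= mesh n) by (intros n; left; apply mesh_pos).
(* Since the scheme stays below [b n <= B], the bound [G] applies at all its nodes. The resulting
   bound on [y] limits the slope, and thereby gives the lower bound on [v] below. *)
assert (Hyb : forall r, U (fun n => 0 <= snd (euler (mesh n) (b n) (node n r)) <= c ^ N * Rmax r 0 ^ N * G)).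
{ intros r. revert Hb. apply filter_imp. intros n Hn. split; [now apply euler_snd_ge0|].
  pose proof (euler_snd_bounds (mesh n) (b n) 0 (node n r) 0 G (Hm n) ltac:(lia)) as H.
  destruct H as [_ H].
  { intros x Hx. split; [apply g_ge0|]. apply HG. cbn in Hx. lra. }
  cbn [snd euler] in H. change (INR 0) with 0 in H. rewrite Rmult_0_l, (pow_i N) in H by lia.
  assert (0 <= G) by (apply Rle_trans with (g B); [apply g_ge0|apply HG; lra]).
  pose proof (node_bounds n r) as H1. 
  assert (H2 : (INR (node n r) * mesh n) ^ N <= Rmax r 0 ^ N).
  { apply pow_incr. split; [|apply H1]. apply Rmult_le_pos; [apply pos_INR|apply Hm]. }
  pose proof cN_pos.
  assert (c ^ N * ((INR (node n r) * mesh n) ^ N - 0) * G <= c ^ N * Rmax r 0 ^ N * G).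
  { apply Rmult_le_compat_r; [lra|]. apply Rmult_le_compat_l; lra. }
  lra. }
assert (Hvb : forall r, U (fun n => A - Rmax r 0 * root N (c ^ N * Rmax r 0 ^ N * G)
     <= fst (euler (mesh n) (b n) (node n r)) <= B)).
{ intros r. generalize (filter_and _ _ Hb (Hyb r)). apply filter_imp. intros n [Hn Hy].
  pose proof (euler_fst_bounds (mesh n) (b n) 0 (node n r) (Hm n) ltac:(lia)) as H.
  cbn [fst euler] in H. change (INR 0) with 0 in H.
  pose proof (euler_fst_le (mesh n) (b n) 0 (node n r) (Hm n) ltac:(lia)) as H0. cbn [fst euler] in H0.
  pose proof (node_bounds n r) as H1. 
  pose proof (root_le N HN _ _ (proj2 Hy)) as H2.
  pose proof (root_ge0 N (snd (euler (mesh n) (b n) (node n r)))) as H3.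
  assert ((INR (node n r) * mesh n - 0 * mesh n) * root N (snd (euler (mesh n) (b n) (node n r)))
    <= Rmax r 0 * root N (c ^ N * Rmax r 0 ^ N * G)).
  { apply Rmult_le_compat; try lra. pose proof (pos_INR (node n r)). pose proof (Hm n). nra. }
  lra. }
assert (Hv : forall r, exists l, filterlim (fun n => fst (euler (mesh n) (b n) (node n r))) U (locally l)).
{ intros r. exact (ultrafilter_lim_bounded U FU U_ultra _ _ _ (Hvb r)). }
assert (Hy : forall r, exists l, filterlim (fun n => snd (euler (mesh n) (b n) (node n r))) U (locally l)).
{ intros r. exact (ultrafilter_lim_bounded U FU U_ultra _ _ _ (Hyb r)). }
clear Hyb Hvb.
set (v := fun r => proj1_sig (constructive_indefinite_description _ (Hv r))).
set (y := fun r => proj1_sig (constructive_indefinite_description _ (Hy r))).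
assert (Lv : forall r, filterlim (fun n => fst (euler (mesh n) (b n) (node n r))) U (locally (v r))).
{ intros r. exact (proj2_sig (constructive_indefinite_description _ (Hv r))). }
assert (Ly : forall r, filterlim (fun n => snd (euler (mesh n) (b n) (node n r))) U (locally (y r))).
{ intros r. exact (proj2_sig (constructive_indefinite_description _ (Hy r))). }
clearbody v y. clear Hv Hy.
assert (Lry : forall r, filterlim (fun n => root N (snd (euler (mesh n) (b n) (node n r)))) U (locally (root N (y r)))).
{ intros r. apply filterlim_R_continuous; [apply FU|apply continuity_root, HN|apply Ly]. }
assert (Lmn : forall r s, filterlim (fun n => INR (node n s) * mesh n - INR (node n r) * mesh n) U
  (locally (Rmax s 0 - Rmax r 0))).
{ intros r s. apply filterlim_R_plus; [apply FU|apply mesh_node_ulim|].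
  apply (filterlim_R_continuous U _ _ _ Ropp); [|apply mesh_node_ulim].
  apply continuity_opp, derivable_continuous, derivable_id. }
assert (Lmp : forall r, filterlim (fun n => (INR (node n r) * mesh n) ^ N) U (locally (Rmax r 0 ^ N))).
{ intros r. apply (filterlim_R_continuous U _ _ _ (fun x => x ^ N)); [|apply mesh_node_ulim].
  apply derivable_continuous, derivable_pow. }
assert (Lminus : forall (p q : nat -> R) lp lq, filterlim p U (locally lp) -> filterlim q U (locally lq) ->
  filterlim (fun n => p n - q n) U (locally (lp - lq))).
{ intros p q lp lq Hp Hq. apply filterlim_R_plus; [apply FU|exact Hp|].
  apply (filterlim_R_continuous U _ _ _ Ropp); [|exact Hq].
  apply continuity_opp, derivable_continuous, derivable_id. }
assert (Luniq : forall (p : nat -> R) l l', filterlim p U (locally l) -> filterlim p U (locally l') -> l = l').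
{ intros p l l' H1 H2. apply Rle_antisym; [apply (filterlim_R_le U FU p p)|apply (filterlim_R_le U FU p p)]; auto;
  apply filter_forall; intros; lra. }
exists a, v, y. split; [exact HaAB|split; [|exact Lv]].
split.
- intros r Hr. apply (Luniq b); [|exact Ha].
  refine (filterlim_ext _ _ _ (Lv r)). intros n. now rewrite node_nonpos.
- intros r Hr. apply (Luniq (fun _ => 0)); [|apply filterlim_const].
  refine (filterlim_ext _ _ _ (Ly r)). intros n. now rewrite node_nonpos.
- intros r s Hrs. refine (filterlim_R_le U FU _ _ _ _ _ (Ly r) (Ly s)).
  apply filter_forall. intros n. apply euler_snd_le; [apply Hm|now apply node_le].
- intros r s Hrs. split.
  + refine (filterlim_R_le U FU _ _ _ _ _ (filterlim_R_mult U _ _ _ _ _ (Lmn r s) (Lry r)) (Lminus _ _ _ _ (Lv r) (Lv s))).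
    apply filter_forall. intros n. apply euler_fst_bounds; [apply Hm|now apply node_le].
  + refine (filterlim_R_le U FU _ _ _ _ _ (Lminus _ _ _ _ (Lv r) (Lv s)) (filterlim_R_mult U _ _ _ _ _ (Lmn r s) (Lry s))).
    apply filter_forall. intros n. apply euler_fst_bounds; [apply Hm|now apply node_le].
- intros r s m M e Hrs He Hg.
  assert (Hn : U (fun n => c ^ N * ((INR (node n s) * mesh n) ^ N - (INR (node n r) * mesh n) ^ N) * m
     <= snd (euler (mesh n) (b n) (node n s)) - snd (euler (mesh n) (b n) (node n r))
     <= c ^ N * ((INR (node n s) * mesh n) ^ N - (INR (node n r) * mesh n) ^ N) * M)).
  (* For [U]-almost all [n] the end values of the scheme are within [e] of [v r] and [v s]. The
     slack [e] in the hypothesis on [g] therefore covers the range of the scheme. *)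
  { generalize (filter_and _ _ (proj1 (filterlim_locally _ _) (Lv r) (mkposreal e He))
      (proj1 (filterlim_locally _ _) (Lv s) (mkposreal e He))).
    apply filter_imp. intros n [H1 H2]. apply Rabs_def2 in H1. apply Rabs_def2 in H2.
    unfold minus, plus, opp in H1, H2; simpl in H1, H2.
    apply euler_snd_bounds; [apply Hm|now apply node_le|]. intros x Hx. apply Hg. lra. }
  assert (Lk : forall k, filterlim (fun n => c ^ N * ((INR (node n s) * mesh n) ^ N - (INR (node n r) * mesh n) ^ N) * k) U
     (locally (c ^ N * (Rmax s 0 ^ N - Rmax r 0 ^ N) * k))).
  { intros k. apply filterlim_R_mult; [apply FU| |apply filterlim_const].
    apply filterlim_R_mult; [apply FU|apply filterlim_const|]. now apply Lminus. }
  split.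
  + refine (filterlim_R_le U FU _ _ _ _ _ (Lk m) (Lminus _ _ _ _ (Ly s) (Ly r))).
    revert Hn. apply filter_imp. tauto.
  + refine (filterlim_R_le U FU _ _ _ _ _ (Lminus _ _ _ _ (Ly s) (Ly r)) (Lk M)).
    revert Hn. apply filter_imp. tauto.
Qed.
End Limit.
End Euler.

(** * Continuity tools and uniqueness of primitives *)

Lemma Rmax0_lip r s : Rabs (Rmax s 0 - Rmax r 0) <= Rabs (s - r).
Proof.
unfold Rmax. destruct (Rle_dec s 0), (Rle_dec r 0); unfold Rabs;
repeat destruct Rcase_abs; lra.
Qed.

Lemma continuity_pt_eps (f : R -> R) x : continuity_pt f x <->
  forall e, 0 < e -> exists d, 0 < d /\ forall t, Rabs (t - x) < d -> Rabs (f t - f x) < e.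
Proof.
split; intros H.
- intros e He. apply continuity_pt_filterlim in H.
  destruct (proj1 (filterlim_locally _ _) H (mkposreal e He)) as [d Hd].
  exists d. split; [apply cond_pos|]. intros t Ht. exact (Hd t Ht).
- apply continuity_pt_filterlim, filterlim_locally. intros e.
  destruct (H e (cond_pos e)) as [d [Hd Hd']]. exists (mkposreal d Hd).
  intros t Ht. exact (Hd' t Ht).
Qed.

Lemma continuity_Rmax0 : continuity (fun r => Rmax r 0).
Proof.
intros r. apply continuity_pt_eps. intros e He. exists e. split; [exact He|].
intros t Ht. pose proof (Rmax0_lip r t). lra.
Qed.

(** The mean value theorem uses derivatives only inside [(0, r)]; at [0], where the system is
    singular, continuity suffices. *)
Lemma eq_of_derivative_eq (p q d : R -> R) : continuity p -> continuity q ->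
  (forall r, 0 < r -> derivable_pt_lim p r (d r)) ->
  (forall r, 0 < r -> derivable_pt_lim q r (d r)) ->
  p 0 = q 0 -> forall r, 0 <= r -> p r = q r.
Proof.
intros Cp Cq Hp Hq H0 r [Hr|<-]; [|exact H0].
destruct (MVT_gen (fun x => p x - q x) 0 r (fun _ => 0)) as [x [_ Hx]].
- intros x Hx. rewrite Rmin_left in Hx by lra.
  apply is_derive_Reals. replace 0 with (d x - d x) by ring.
  apply derivable_pt_lim_minus; [apply Hp|apply Hq]; lra.
- intros x _. now apply continuity_pt_minus.
- lra.
Qed.

(** * Endpoint estimates and differentiability of limit solutions *)

Section Solution.
Variables (N : nat) (c : R) (g : R -> R).
Hypothesis HN : (1 <= N)%nat.
Hypothesis Hc : 0 < c.
Hypothesis g_cont : continuity g.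
Hypothesis g_ge0 : forall s, 0 <= g s.
Variables (a : R) (v y : R -> R).
Hypothesis Hsol : ivp_solution N c g a v y.

Lemma ivp_y_ge0 r : 0 <= y r.
Proof.
destruct (Rle_lt_dec r 0) as [h|h].
- rewrite (ivp_y_le0 _ _ _ _ _ _ Hsol r h). lra.
- rewrite <- (ivp_y_le0 _ _ _ _ _ _ Hsol 0 (Rle_refl 0)).
  apply (ivp_y_le _ _ _ _ _ _ Hsol). lra.
Qed.

Lemma ivp_v_bounds_ge0 r s : 0 <= r <= s ->
  (s - r) * root N (y r) <= v r - v s <= (s - r) * root N (y s).
Proof.
intros H. pose proof (ivp_v_bounds _ _ _ _ _ _ Hsol r s (proj2 H)) as H1.
rewrite !Rmax_left in H1 by lra. exact H1.
Qed.

Lemma ivp_v_noninc r s : r <= s -> v s <= v r.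
Proof.
intros H. pose proof (ivp_v_bounds _ _ _ _ _ _ Hsol r s H) as [H1 _].
assert (0 <= Rmax s 0 - Rmax r 0).
{ pose proof (Rle_max_compat_r r s 0 H). lra. }
pose proof (Rmult_le_pos _ _ H0 (root_ge0 N (y r))). lra.
Qed.

(** On [[0, 1]] the bound on [g] gives [y <= c ^ N * G], so the slope is at most [c * root N G], and
    so is the total drop of [v]. The range up to [a + 1] comes from taking slack [1] in
    [ivp_y_bounds]. *)
Lemma ivp_v1_lower G : (forall x, x <= a + 1 -> g x <= G) -> a - c * root N G <= v 1.
Proof.
intros HG.
pose proof (ivp_y_bounds _ _ _ _ _ _ Hsol 0 1 0 G 1 ltac:(lra) ltac:(lra)) as [_ H].
{ intros x Hx. split; [apply g_ge0|apply HG].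
  rewrite (ivp_v_le0 _ _ _ _ _ _ Hsol 0) in Hx; lra. }
rewrite (ivp_y_le0 _ _ _ _ _ _ Hsol 0), Rmax_left, Rmax_left, pow1, pow_i in H by (lra || lia).
pose proof (ivp_v_bounds_ge0 0 1 ltac:(lra)) as [_ H1].
rewrite (ivp_v_le0 _ _ _ _ _ _ Hsol 0) in H1 by lra.
assert (HG0 : 0 <= G) by (apply Rle_trans with (g a); [apply g_ge0|apply HG; lra]).
assert (root N (y 1) <= c * root N G).
{ apply (pow_le_cancel N HN); [apply Rmult_le_pos; [lra|apply root_ge0]|].
  rewrite Rpow_mult_distr, !root_pow; try lra; [exact HN|exact HN|apply ivp_y_ge0]. }
lra.
Qed.

(* If [v 1 >= 0], concavity keeps [v] above [a / 2] on [0, 1/2], where the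
   lower bound on [g] forces the slope at [1/4] to be at least [4 a]. *)
Lemma ivp_v1_neg G : 0 < a -> (forall x, x <= 2 * a -> g x <= G) ->
  (forall x, a / 4 <= x <= 2 * a -> (64 / c) ^ N * x ^ N <= g x) -> v 1 < 0.
Proof.
intros Ha HG Hg. destruct (Rlt_le_dec (v 1) 0) as [h|h]; [exact h|exfalso].
assert (Hv0 : v 0 = a) by (apply (ivp_v_le0 _ _ _ _ _ _ Hsol); lra).
pose proof (ivp_v_bounds_ge0 0 (1/2) ltac:(lra)) as [_ H1].
pose proof (ivp_v_bounds_ge0 (1/2) 1 ltac:(lra)) as [H2 _].
pose proof (ivp_v_bounds_ge0 (1/4) (1/2) ltac:(lra)) as [H3 _].
pose proof (ivp_v_noninc 0 (1/4) ltac:(lra)) as H4.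
pose proof (ivp_v_noninc (1/4) (1/2) ltac:(lra)) as H5.
assert (Hy : (4 * a) ^ N <= y (1/4)).
(* The slack [a / 4] lowers the range of arguments from [a / 2] to [a / 4]. The constant [64] makes
   [c * (1/4) * (64/c) * (a/4)] equal to [4 * a], so that [v] would drop by at least [a] on
   [[1/4, 1/2]]. *)
{ pose proof (ivp_y_bounds _ _ _ _ _ _ Hsol 0 (1/4) ((64 / c) ^ N * (a / 4) ^ N) G (a / 4) ltac:(lra) ltac:(lra)) as [H _].
  { intros x Hx. split; [|apply HG; lra].
    apply Rle_trans with ((64 / c) ^ N * x ^ N); [|apply Hg; lra].
    apply Rmult_le_compat_l; [apply pow_le; apply Rlt_le, Rdiv_lt_0_compat; lra|].
    apply pow_incr. lra. }
  rewrite (ivp_y_le0 _ _ _ _ _ _ Hsol 0), Rmax_left, Rmax_left, (pow_i N) in H by (lra || lia).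
  rewrite !Rminus_0_r, <- !Rpow_mult_distr in H.
  replace (c * (1 / 4) * (64 / c * (a / 4))) with (4 * a) in H by (field; lra).
  exact H. }
assert (4 * a <= root N (y (1/4))).
{ rewrite <- (pow_root N HN (4 * a)) by lra. now apply root_le. }
lra.
Qed.

Lemma continuity_ivp_v : continuity v.
Proof.
intros r. apply continuity_pt_eps. intros e He.
(* Monotonicity of [y] makes [K] a bound on the slope at all arguments within distance [1] of [r],
   hence a local Lipschitz constant. *)
set (K := root N (y (r + 1))). assert (HK : 0 <= K) by apply root_ge0.
exists (Rmin 1 (e / (K + 1))).
split; [apply Rmin_pos; [lra|apply Rdiv_lt_0_compat; lra]|].
intros s Hs.
assert (H1 : Rabs (s - r) < 1) by (eapply Rlt_le_trans; [exact Hs|apply Rmin_l]).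
assert (H2 : Rabs (s - r) < e / (K + 1)) by (eapply Rlt_le_trans; [exact Hs|apply Rmin_r]).
assert (H3 : Rabs (s - r) * (K + 1) < e).
{ apply Rmult_lt_reg_r with (/ (K + 1)); [apply Rinv_0_lt_compat; lra|].
  rewrite Rmult_assoc, Rinv_r by lra. unfold Rdiv in H2. lra. }
assert (H4 : Rabs (v s - v r) <= Rabs (Rmax s 0 - Rmax r 0) * K).
{ apply Rabs_def2 in H1. destruct (Rle_lt_dec r s) as [h|h].
  - pose proof (ivp_v_bounds _ _ _ _ _ _ Hsol r s h) as H.
    pose proof (Rle_max_compat_r r s 0 h). pose proof (ivp_v_noninc r s h).
    rewrite (Rabs_left1 (v s - v r)), (Rabs_right (Rmax s 0 - Rmax r 0)) by lra.
    apply Rle_trans with ((Rmax s 0 - Rmax r 0) * root N (y s)); [lra|].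
    apply Rmult_le_compat_l; [lra|]. apply root_le, (ivp_y_le _ _ _ _ _ _ Hsol); [exact HN|lra].
  - apply Rlt_le in h. pose proof (ivp_v_bounds _ _ _ _ _ _ Hsol s r h) as H.
    pose proof (Rle_max_compat_r s r 0 h). pose proof (ivp_v_noninc s r h).
    rewrite (Rabs_right (v s - v r)), (Rabs_left1 (Rmax s 0 - Rmax r 0)) by lra.
    apply Rle_trans with ((Rmax r 0 - Rmax s 0) * root N (y r)); [lra|].
    replace (- (Rmax s 0 - Rmax r 0)) with (Rmax r 0 - Rmax s 0) by ring.
    apply Rmult_le_compat_l; [lra|]. apply root_le, (ivp_y_le _ _ _ _ _ _ Hsol); [exact HN|lra]. }
pose proof (Rmax0_lip r s). pose proof (Rabs_pos (s - r)).
assert (Rabs (Rmax s 0 - Rmax r 0) * K <= Rabs (s - r) * K) by (apply Rmult_le_compat_r; lra).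
lra.
Qed.

(** This differentiates [y] with respect to the variable [r ^ N], by continuity of [g] and [v]. In
    this form it also covers [r = 0], where it gives the leading behaviour of [y]. *)
Lemma ivp_y_local r e : 0 < e -> exists d, 0 < d /\ forall s, Rabs (s - r) < d ->
  Rabs (y s - y r - c ^ N * g (v r) * (Rmax s 0 ^ N - Rmax r 0 ^ N))
  <= e * Rabs (Rmax s 0 ^ N - Rmax r 0 ^ N).
Proof.
intros He. assert (HcN := cN_pos N c Hc).
set (e1 := e / c ^ N). assert (He1 : 0 < e1) by now apply Rdiv_lt_0_compat.
destruct (proj1 (continuity_pt_eps g (v r)) (g_cont (v r)) e1 He1) as [d1 [Hd1 Hg]].
(* One quarter of [d1] bounds the variation of [v] and another is the slack in [ivp_y_bounds];
   together they stay below [d1]. *)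
destruct (proj1 (continuity_pt_eps v r) (continuity_ivp_v r) (d1 / 4) ltac:(lra)) as [d [Hd Hv]].
exists d. split; [exact Hd|]. intros s Hs. specialize (Hv s Hs). apply Rabs_def2 in Hv.
assert (Hg' : forall x, Rabs (x - v r) < d1 -> g (v r) - e1 <= g x <= g (v r) + e1).
{ intros x Hx. specialize (Hg x Hx). apply Rabs_def2 in Hg. lra. }
assert (Hpow : forall p q, p <= q -> Rmax p 0 ^ N <= Rmax q 0 ^ N).
{ intros p q Hpq. apply pow_incr. split; [apply Rmax_r|now apply Rle_max_compat_r]. }
replace e with (c ^ N * e1) by (unfold e1; field; lra).
destruct (Rle_lt_dec r s) as [h|h].
- pose proof (ivp_y_bounds _ _ _ _ _ _ Hsol r s (g (v r) - e1) (g (v r) + e1) (d1 / 4) h ltac:(lra)) as H.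
  destruct H as [HA HB]. { intros x Hx. apply Hg', Rabs_def1; lra. }
  rewrite (Rabs_right (Rmax s 0 ^ N - _)) by (generalize (Hpow _ _ h); lra).
  apply Rabs_le. split; lra.
- apply Rlt_le in h.
  pose proof (ivp_y_bounds _ _ _ _ _ _ Hsol s r (g (v r) - e1) (g (v r) + e1) (d1 / 4) h ltac:(lra)) as H.
  destruct H as [HA HB]. { intros x Hx. apply Hg', Rabs_def1; lra. }
  rewrite (Rabs_left1 (Rmax s 0 ^ N - _)) by (generalize (Hpow _ _ h); lra).
  apply Rabs_le. split; lra.
Qed.

Lemma continuity_ivp_y : continuity y.
Proof.
intros r. apply continuity_pt_eps. intros e He.
destruct (ivp_y_local r 1 Rlt_0_1) as [d1 [Hd1 H1]].
set (K := c ^ N * g (v r)).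
assert (HK : 0 <= K) by (apply Rmult_le_pos; [apply Rlt_le, cN_pos, Hc|apply g_ge0]).
assert (C : continuity_pt (fun s => Rmax s 0 ^ N) r).
{ apply (continuity_pt_comp (fun s => Rmax s 0) (fun x => x ^ N)); [apply continuity_Rmax0|].
  apply derivable_continuous, derivable_pow. }
destruct (proj1 (continuity_pt_eps _ _) C (e / (K + 2)) ltac:(apply Rdiv_lt_0_compat; lra)) as [d2 [Hd2 H2]].
exists (Rmin d1 d2). split; [now apply Rmin_pos|]. intros s Hs.
specialize (H1 s ltac:(eapply Rlt_le_trans; [exact Hs|apply Rmin_l])).
specialize (H2 s ltac:(eapply Rlt_le_trans; [exact Hs|apply Rmin_r])). cbv beta in H2.
fold K in H1. set (p := Rmax s 0 ^ N - Rmax r 0 ^ N) in *.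
assert (H3 : Rabs p * (K + 2) < e).
{ apply Rmult_lt_reg_r with (/ (K + 2)); [apply Rinv_0_lt_compat; lra|].
  rewrite Rmult_assoc, Rinv_r by lra. unfold Rdiv in H2. lra. }
replace (y s - y r) with ((y s - y r - K * p) + K * p) by ring.
pose proof (Rabs_triang (y s - y r - K * p) (K * p)). rewrite (Rabs_mult K p) in H.
rewrite (Rabs_right K) in H by lra. pose proof (Rabs_pos p). nra.
Qed.

Lemma continuity_ivp_slope : continuity (fun r => root N (y r)).
Proof. exact (continuity_comp _ _ continuity_ivp_y (continuity_root N HN)). Qed.

Lemma derivable_ivp_y r : 0 < r ->
  derivable_pt_lim y r (c ^ N * INR N * r ^ (N - 1) * g (v r)).
Proof.
intros Hr e He.
set (K := c ^ N * g (v r)). set (L := INR N * r ^ pred N).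
assert (HK : 0 <= K) by (apply Rmult_le_pos; [apply Rlt_le, cN_pos, Hc|apply g_ge0]).
assert (HL : 0 <= L) by (apply Rmult_le_pos; [apply pos_INR|apply pow_le; lra]).
(* A chain rule through [r ^ N] with quotient [P / h]. As [Rabs (P / h) <= L + 1], this choice keeps
   the error of [y] against [K * P] below [e / 2]; [e2] keeps [K * Rabs (P / h - L)] within the
   other half. *)
destruct (ivp_y_local r (e / 2 / (L + 2))) as [d1 [Hd1 H1]].
{ apply Rdiv_lt_0_compat; lra. }
set (e2 := Rmin 1 (e / 2 / (K + 1))).
assert (He2 : 0 < e2).
{ apply Rmin_pos; [lra|]. apply Rdiv_lt_0_compat; lra. }
destruct (derivable_pt_lim_pow r N e2 He2) as [d2 H2].
assert (Hd : 0 < Rmin (Rmin d1 d2) r).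
{ apply Rmin_pos; [|exact Hr]. apply Rmin_pos; [exact Hd1|apply cond_pos]. }
exists (mkposreal _ Hd). intros h Hh0 Hh. simpl in Hh.
assert (Hh1 : Rabs h < d1).
{ eapply Rlt_le_trans; [exact Hh|]. eapply Rle_trans; [apply Rmin_l|apply Rmin_l]. }
assert (Hh2 : Rabs h < d2).
{ eapply Rlt_le_trans; [exact Hh|]. eapply Rle_trans; [apply Rmin_l|apply Rmin_r]. }
assert (Hh3 : Rabs h < r) by (eapply Rlt_le_trans; [exact Hh|apply Rmin_r]).
specialize (H1 (r + h)). replace (r + h - r) with h in H1 by ring. specialize (H1 Hh1).
specialize (H2 h Hh0 Hh2). apply Rabs_def2 in Hh3.
rewrite !Rmax_left in H1 by lra. fold K in H1. fold L in H2.
set (P := (r + h) ^ N - r ^ N) in *.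
assert (He21 : e2 <= 1) by apply Rmin_l.
assert (He22 : K * e2 <= e / 2).
{ apply Rle_trans with ((K + 1) * e2); [nra|].
  apply Rle_trans with ((K + 1) * (e / 2 / (K + 1))); [|right; field; lra].
  apply Rmult_le_compat_l; [lra|apply Rmin_r]. }
assert (HP : Rabs (P / h) <= L + 1).
{ replace (P / h) with ((P / h - L) + L) by ring.
  eapply Rle_trans; [apply Rabs_triang|]. rewrite (Rabs_right L) by lra. lra. }
replace (c ^ N * INR N * r ^ (N - 1) * g (v r)) with (K * L)
  by (unfold K, L; replace (N - 1)%nat with (pred N) by lia; ring).
replace ((y (r + h) - y r) / h - K * L) with
  ((y (r + h) - y r - K * P) / h + K * (P / h - L)) by (field; exact Hh0).
eapply Rle_lt_trans; [apply Rabs_triang|].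
rewrite (Rabs_mult K), (Rabs_right K) by lra.
assert (A1 : Rabs ((y (r + h) - y r - K * P) / h) <= e / 2 / (L + 2) * (L + 1)).
{ unfold Rdiv at 1. rewrite Rabs_mult.
  apply Rle_trans with (e / 2 / (L + 2) * Rabs (P / h)).
  - unfold Rdiv at 3. rewrite Rabs_mult, <- Rmult_assoc.
    apply Rmult_le_compat_r; [apply Rabs_pos|exact H1].
  - apply Rmult_le_compat_l; [|exact HP]. left. apply Rdiv_lt_0_compat; lra. }
assert (A2 : e / 2 / (L + 2) * (L + 1) < e / 2).
{ apply Rlt_le_trans with (e / 2 / (L + 2) * (L + 2)); [|right; field; lra].
  apply Rmult_lt_compat_l; [apply Rdiv_lt_0_compat; lra|lra]. }
assert (A3 : K * Rabs (P / h - L) <= K * e2) by (apply Rmult_le_compat_l; lra).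
lra.
Qed.

(** The increment bounds squeeze the difference quotient between minus the slopes at the two ends,
    and the slope is continuous. *)
Lemma derivable_ivp_v r : 0 < r -> derivable_pt_lim v r (- root N (y r)).
Proof.
intros Hr e He.
destruct (proj1 (continuity_pt_eps _ _) (continuity_ivp_slope r) e He) as [d [Hd H]].
assert (Hd' : 0 < Rmin d r) by now apply Rmin_pos.
exists (mkposreal _ Hd'). intros h Hh0 Hh. simpl in Hh.
assert (Hh1 : Rabs h < d) by (eapply Rlt_le_trans; [exact Hh|apply Rmin_l]).
assert (Hh3 : Rabs h < r) by (eapply Rlt_le_trans; [exact Hh|apply Rmin_r]).
specialize (H (r + h)). replace (r + h - r) with h in H by ring. specialize (H Hh1).
apply Rabs_def2 in Hh3. apply Rabs_def2 in H.
set (q := (v (r + h) - v r) / h).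
assert (Hq : v (r + h) - v r = q * h) by (unfold q; field; exact Hh0).
destruct (Rdichotomy _ _ Hh0) as [h0|h0].
- pose proof (ivp_v_bounds_ge0 (r + h) r ltac:(lra)) as [HA HB].
  replace (r - (r + h)) with (- h) in HA, HB by ring.
  assert (- root N (y r) <= q <= - root N (y (r + h)))
    by (split; apply (Rmult_le_reg_r (- h)); lra).
  apply Rabs_def1; lra.
- pose proof (ivp_v_bounds_ge0 r (r + h) ltac:(lra)) as [HA HB].
  replace (r + h - r) with h in HA, HB by ring.
  assert (- root N (y (r + h)) <= q <= - root N (y r))
    by (split; apply (Rmult_le_reg_r h); lra).
  apply Rabs_def1; lra.
Qed.

(** * Behaviour at the origin and [C^2] regularity *)

Hypothesis Hga : 0 < g a.

(** Near [0], [y s] is at least half of [c ^ N * g a * s ^ N]; monotonicity carries positivity to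
    larger arguments. *)
Lemma ivp_y_pos r : 0 < r -> 0 < y r.
Proof.
intros Hr. assert (HK : 0 < c ^ N * g a) by (apply Rmult_lt_0_compat; [apply cN_pos, Hc|exact Hga]).
destruct (ivp_y_local 0 (c ^ N * g a / 2) ltac:(lra)) as [d [Hd H]].
set (s := Rmin (d / 2) r). assert (Hs : 0 < s) by (apply Rmin_pos; lra).
assert (Hs' : s <= d / 2) by apply Rmin_l.
specialize (H s). rewrite Rminus_0_r, (Rabs_right s) in H by lra. specialize (H ltac:(lra)).
rewrite (ivp_v_le0 _ _ _ _ _ _ Hsol 0), (ivp_y_le0 _ _ _ _ _ _ Hsol 0), !Rmax_left, (pow_i N) in H by (lra || lia).
pose proof (pow_lt s N Hs). rewrite !Rminus_0_r in H. rewrite (Rabs_right (s ^ N)) in H by lra.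
assert (y s <= y r) by (apply (ivp_y_le _ _ _ _ _ _ Hsol); apply Rmin_r).
assert (0 < c ^ N * g a * s ^ N) by now apply Rmult_lt_0_compat.
pose proof (Rabs_maj2 (y s - c ^ N * g a * s ^ N)). lra.
Qed.

(** The continuous extension of [y r / r ^ N] by its limit at [0]. It is positive everywhere and
    splits the slope as [r * root N (ivp_ratio r)], which isolates the degeneracy at the origin. *)
Definition ivp_ratio (r : R) : R := if Rle_dec r 0 then c ^ N * g a else y r / r ^ N.

Lemma ivp_ratio_pos r : 0 < ivp_ratio r.
Proof.
unfold ivp_ratio. destruct (Rle_dec r 0).
- apply Rmult_lt_0_compat; [apply cN_pos, Hc|exact Hga].
- apply Rdiv_lt_0_compat; [apply ivp_y_pos; lra|apply pow_lt; lra].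
Qed.

Lemma continuity_ivp_ratio : continuity ivp_ratio.
Proof.
intros r. destruct (Rtotal_order r 0) as [h|[->|h]].
- apply continuity_pt_eps. intros e He. exists (- r). split; [lra|]. intros t Ht.
  apply Rabs_def2 in Ht. unfold ivp_ratio.
  destruct (Rle_dec r 0), (Rle_dec t 0); try lra. rewrite Rminus_diag, Rabs_R0. lra.
- apply continuity_pt_eps. intros e He.
  destruct (ivp_y_local 0 (e / 2) ltac:(lra)) as [d [Hd H]].
  exists d. split; [exact Hd|]. intros t Ht. specialize (H t Ht).
  unfold ivp_ratio. destruct (Rle_dec 0 0); [|lra]. destruct (Rle_dec t 0) as [h|h].
  + rewrite Rminus_diag, Rabs_R0. lra.
  + rewrite (ivp_v_le0 _ _ _ _ _ _ Hsol 0), (ivp_y_le0 _ _ _ _ _ _ Hsol 0), !Rmax_left, (pow_i N) in H by (lra || lia).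
    assert (Hp : 0 < t ^ N) by (apply pow_lt; lra). rewrite !Rminus_0_r in H.
    replace (y t / t ^ N - c ^ N * g a) with ((y t - c ^ N * g a * t ^ N) / t ^ N) by (field; lra).
    unfold Rdiv. rewrite Rabs_mult, (Rabs_inv (t ^ N)).
    apply Rle_lt_trans with (e / 2); [|lra].
    apply (Rmult_le_reg_r (Rabs (t ^ N))); [apply Rabs_pos_lt; lra|].
    rewrite Rmult_assoc, Rinv_l, Rmult_1_r; [exact H|]. apply Rabs_no_R0. lra.
- apply continuity_pt_filterlim.
  apply (filterlim_ext_loc (fun t => y t / t ^ N)).
  + exists (mkposreal r h). intros t Ht. apply Rabs_def2 in Ht.
    unfold minus, plus, opp in Ht; simpl in Ht.
    unfold ivp_ratio. destruct (Rle_dec t 0); [lra|reflexivity].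
  + unfold ivp_ratio. destruct (Rle_dec r 0); [lra|].
    apply (continuity_pt_filterlim (fun t => y t / t ^ N)).
    apply (continuity_pt_div y (fun t => t ^ N)).
    * apply continuity_ivp_y.
    * apply derivable_continuous, derivable_pow.
    * apply pow_nonzero. lra.
Qed.

(* The formula for [v'' = - ivp_accel] with the powers of [r] cancelled, so that it
   stays continuous at [0]. *)
Definition ivp_accel (r : R) : R := c ^ N * g (v r) / root N (ivp_ratio r) ^ (N - 1).

Lemma continuity_ivp_accel : continuity ivp_accel.
Proof.
intros r. apply (continuity_pt_div (fun r => c ^ N * g (v r)) (fun r => root N (ivp_ratio r) ^ (N - 1))).
- apply (continuity_pt_scal (fun r => g (v r))).
  exact (continuity_comp _ _ continuity_ivp_v g_cont r).
- apply (continuity_pt_comp (fun r => root N (ivp_ratio r)) (fun x => x ^ (N - 1))).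
  + exact (continuity_comp _ _ continuity_ivp_ratio (continuity_root N HN) r).
  + apply derivable_continuous, derivable_pow.
- apply pow_nonzero. pose proof (root_pos N _ (ivp_ratio_pos r)). lra.
Qed.

Lemma ivp_slope_ratio r : 0 < r -> root N (y r) = r * root N (ivp_ratio r).
Proof.
intros Hr. rewrite <- (pow_root N HN (r * _)).
- rewrite Rpow_mult_distr, root_pow; [|exact HN|left; apply ivp_ratio_pos].
  f_equal. unfold ivp_ratio. destruct (Rle_dec r 0); [lra|]. field. apply pow_nonzero. lra.
- apply Rmult_le_pos; [lra|apply root_ge0].
Qed.

Lemma derivable_root x : 0 < x -> derivable_pt_lim (root N) x (/ (INR N * root N x ^ (N - 1))).
Proof.
intros Hx. pose proof (INR_N_pos N HN). pose proof (root_pos N x Hx) as Hrp.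
assert (E : / (INR N * root N x ^ (N - 1)) = / INR N * Rpower x (/ INR N - 1)).
{ unfold Rminus. rewrite Rpower_plus, Rpower_Ropp, Rpower_1 by exact Hx.
  assert (Hr : root N x = Rpower x (/ INR N)).
  { unfold root. destruct (Rlt_dec 0 x); [reflexivity|lra]. }
  rewrite <- Hr. rewrite <- (root_pow N HN x) at 3 by lra.
  replace (root N x ^ N) with (root N x * root N x ^ (N - 1)).
  - field. repeat split; try lra. apply pow_nonzero; lra.
  - destruct N as [|n]; [lia|]. simpl. now rewrite Nat.sub_0_r. }
rewrite E. apply is_derive_Reals.
apply (is_derive_ext_loc (fun t => Rpower t (/ INR N))).
- exists (mkposreal x Hx). intros t Ht. apply Rabs_def2 in Ht.
  unfold minus, plus, opp in Ht; simpl in Ht.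
  unfold root. destruct (Rlt_dec 0 t); [reflexivity|lra].
- apply is_derive_Reals. now apply derivable_pt_lim_power.
Qed.

Lemma derivable_ivp_slope r : 0 < r ->
  derivable_pt_lim (fun t => root N (y t)) r (ivp_accel r).
Proof.
intros Hr.
replace (ivp_accel r) with
  (/ (INR N * root N (y r) ^ (N - 1)) * (c ^ N * INR N * r ^ (N - 1) * g (v r))).
- apply (derivable_pt_lim_comp y (root N)); [now apply derivable_ivp_y|].
  apply derivable_root. now apply ivp_y_pos.
- rewrite ivp_slope_ratio, Rpow_mult_distr by exact Hr. unfold ivp_accel. field.
  pose proof (INR_N_pos N HN). pose proof (root_pos N _ (ivp_ratio_pos r)).
  repeat split; try lra; apply pow_nonzero; lra.
Qed.

(** [MO_solution] asks for derivatives on the whole line, whereas [v], constant on the left of [0],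
    has a jump in its second derivative there. Integrating the continuous [ivp_accel] twice from [0]
    gives a [C^2] function that agrees with [v] on [[0, +oo)]. *)
Lemma ivp_C2_extension : exists u w d : R -> R,
  (forall x, derivable_pt_lim u x (- w x)) /\ (forall x, derivable_pt_lim w x (d x)) /\
  continuity d /\ (forall r, 0 <= r -> u r = v r) /\ (forall r, 0 <= r -> w r = root N (y r)).
Proof.
assert (Hprim : forall f : R -> R, continuity f ->
  forall x, derivable_pt_lim (fun t => RInt f 0 t) x (f x)).
{ intros f Cf x. apply is_derive_Reals. apply (is_derive_RInt f (fun t => RInt f 0 t) 0 x).
  - apply filter_forall. intros t. apply (RInt_correct (V := R_CompleteNormedModule)),
      (ex_RInt_continuous (V := R_CompleteNormedModule)).
    intros z _. apply continuity_pt_filterlim, Cf.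
  - apply continuity_pt_filterlim, Cf. }
set (w := fun x => RInt ivp_accel 0 x).
assert (Hw : forall x, derivable_pt_lim w x (ivp_accel x)) by exact (Hprim _ continuity_ivp_accel).
assert (Cw : continuity w).
{ intros x. apply derivable_continuous_pt. exact (exist _ _ (Hw x)). }
assert (Ew : forall r, 0 <= r -> w r = root N (y r)).
{ apply (eq_of_derivative_eq w _ ivp_accel Cw continuity_ivp_slope).
  - intros r _. apply Hw.
  - exact derivable_ivp_slope.
  - unfold w. rewrite RInt_point, (ivp_y_le0 _ _ _ _ _ _ Hsol 0), root_0 by lra. reflexivity. }
set (u := fun x => a - RInt w 0 x).
assert (Hu : forall x, derivable_pt_lim u x (- w x)).
{ intros x. replace (- w x) with (0 - w x) by ring.
  apply (derivable_pt_lim_minus (fun _ => a) (fun x => RInt w 0 x)); [apply derivable_pt_lim_const|].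
  now apply Hprim. }
exists u, w, ivp_accel.
split; [exact Hu|split; [exact Hw|split; [exact continuity_ivp_accel|split; [|exact Ew]]]].
apply (eq_of_derivative_eq u v (fun r => - w r)).
- intros x. apply derivable_continuous_pt. exact (exist _ _ (Hu x)).
- apply continuity_ivp_v.
- intros r _. apply Hu.
- intros r Hr. rewrite Ew by lra. now apply derivable_ivp_v.
- unfold u. rewrite RInt_point, (ivp_v_le0 _ _ _ _ _ _ Hsol 0) by lra.
  unfold zero; simpl. ring.
Qed.

End Solution.

(** * From limit solutions to positive concave solutions of the boundary value problem *)

(** [w] stands for [- u']. Positivity and strict concavity are included so that both signs of (MO)
    inherit them from a single statement. *)
Definition radial_solution (N : nat) (c : R) (g u : R -> R) : Prop :=
  exists w d : R -> R,
    (forall x, derivable_pt_lim u x (- w x)) /\ (forall x, derivable_pt_lim w x (d x)) /\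
    continuity d /\
    (forall r, 0 < r < 1 ->
       derivable_pt_lim (fun t => w t ^ N) r (c ^ N * INR N * r ^ (N - 1) * g (u r))) /\
    w 0 = 0 /\ u 1 = 0 /\ (forall r, 0 < r < 1 -> 0 < u r) /\ strictly_concave_on_01 u.

Lemma strictly_concave_on_01_lt (u : R -> R) :
  (forall x y t, 0 < x -> x < y -> y < 1 -> 0 < t < 1 ->
    u (t * x + (1 - t) * y) > t * u x + (1 - t) * u y) -> strictly_concave_on_01 u.
Proof.
intros H x y t Hx Hy Hxy Ht. destruct (Rdichotomy _ _ Hxy) as [h|h].
- apply H; lra.
- specialize (H y x (1 - t) ltac:(lra) h ltac:(lra) ltac:(lra)).
  replace (1 - (1 - t)) with t in H by ring.
  rewrite (Rplus_comm (t * x)), (Rplus_comm (t * u x)). exact H.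
Qed.

(** The slope is positive, so [v] decreases strictly to [v 1 = 0] and is positive before. Then
    [y' > 0] on [(0, 1)], the slope increases strictly, and strict concavity follows. *)
Lemma ivp_radial_solution N c g a v y : (1 <= N)%nat -> 0 < c -> continuity g ->
  (forall s, 0 <= g s) -> (forall s, 0 < s -> 0 < g s) -> 0 < a ->
  ivp_solution N c g a v y -> v 1 = 0 ->
  exists u, radial_solution N c g u /\ u 0 = a.
Proof.
intros HN Hc Cg g0 gp Ha Hs Hv1.
destruct (ivp_C2_extension N c g HN Hc Cg g0 a v y Hs (gp a Ha)) as [u [w [d [Hu [Hw [Cd [Eu Ew]]]]]]].
assert (Hpos : forall r, 0 < r < 1 -> 0 < v r).
{ intros r Hr. pose proof (ivp_v_bounds_ge0 N c g a v y Hs r 1 ltac:(lra)) as [H _].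
  pose proof (root_pos N _ (ivp_y_pos N c g HN Hc Cg a v y Hs (gp a Ha) r (proj1 Hr))) as H1.
  assert (0 < (1 - r) * root N (y r)) by (apply Rmult_lt_0_compat; lra). lra. }
assert (Hinc : forall r s, 0 < r -> r < s -> s < 1 -> root N (y r) < root N (y s)).
{ intros r s Hr Hrs Hs1. apply (root_lt N HN). split; [exact (ivp_y_ge0 N c g a v y Hs r)|].
  destruct (MVT_gen y r s (fun x => c ^ N * INR N * x ^ (N - 1) * g (v x))) as [x [Hx Hx']].
  - intros x Hx. rewrite Rmin_left in Hx by lra.
    apply is_derive_Reals. apply (derivable_ivp_y N c g HN Hc Cg g0 a v y Hs). lra.
  - intros x Hx. apply (continuity_ivp_y N c g HN Hc Cg g0 a v y Hs).
  - rewrite Rmin_left, Rmax_right in Hx by lra.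
    assert (0 < c ^ N * INR N * x ^ (N - 1) * g (v x) * (s - r)).
    { repeat apply Rmult_lt_0_compat; try lra.
      - now apply pow_lt.
      - now apply INR_N_pos.
      - apply pow_lt; lra.
      - apply gp, Hpos; lra. }
    lra. }
exists u. split; [|rewrite Eu by lra; apply (ivp_v_le0 _ _ _ _ _ _ Hs); lra].
exists w, d. repeat (split; [assumption|]).
split; [|split; [|split; [|split]]].
- intros r Hr. apply is_derive_Reals. apply (is_derive_ext_loc y).
  + exists (mkposreal r (proj1 Hr)). intros t Ht. apply Rabs_def2 in Ht.
    unfold minus, plus, opp in Ht; simpl in Ht.
    rewrite Ew by lra. rewrite root_pow; [reflexivity|exact HN|apply (ivp_y_ge0 N c g a v y Hs)].
  + rewrite Eu by lra. apply is_derive_Reals.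
    apply (derivable_ivp_y N c g HN Hc Cg g0 a v y Hs). lra.
- rewrite Ew, (ivp_y_le0 _ _ _ _ _ _ Hs 0) by lra. apply root_0.
- rewrite Eu by lra. exact Hv1.
- intros r Hr. rewrite Eu by lra. now apply Hpos.
- apply strictly_concave_on_01_lt. intros p q t Hp Hpq Hq Ht.
  set (z := t * p + (1 - t) * q).
  assert (Hz1 : z - p = (1 - t) * (q - p)) by (unfold z; ring).
  assert (Hz2 : q - z = t * (q - p)) by (unfold z; ring).
  assert (0 < (1 - t) * (q - p)) by (apply Rmult_lt_0_compat; lra).
  assert (0 < t * (q - p)) by (apply Rmult_lt_0_compat; lra).
  rewrite !Eu by lra.
  (* The increment bounds are non-strict; cutting [[z, q]] at an interior point [m] gains strictness
     from the slope at [m] exceeding the slope at [z]. *)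
  set (m := (z + q) / 2).
  assert (Hm : z < m < q) by (unfold m; lra).
  pose proof (ivp_v_bounds_ge0 N c g a v y Hs p z ltac:(lra)) as [_ H1].
  pose proof (ivp_v_bounds_ge0 N c g a v y Hs z m ltac:(lra)) as [H2 _].
  pose proof (ivp_v_bounds_ge0 N c g a v y Hs m q ltac:(lra)) as [H3 _].
  pose proof (Hinc z m ltac:(lra) ltac:(lra) ltac:(lra)) as H4.
  assert (H5 : (q - m) * root N (y z) < (q - m) * root N (y m)) by (apply Rmult_lt_compat_l; lra).
  set (k := root N (y z)) in *.
  assert (H6 : (q - z) * k < v z - v q) by lra.
  rewrite Hz1 in H1. rewrite Hz2 in H6.
  assert (H7 : t * (v p - v z) <= t * ((1 - t) * (q - p) * k)) by (apply Rmult_le_compat_l; lra).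
  assert (H8 : (1 - t) * (t * (q - p) * k) < (1 - t) * (v z - v q)) by (apply Rmult_lt_compat_l; lra).
  lra.
Qed.

(** * Shooting with the scheme, then with its limit *)

Section Shooting.
Variables (N : nat) (c : R) (g : R -> R).
Hypothesis HN : (1 <= N)%nat.
Hypothesis Hc : 0 < c.
Hypothesis g_cont : continuity g.
Hypothesis g_ge0 : forall s, 0 <= g s.
Hypothesis g_bounded : forall B, exists G, forall x, x <= B -> g x <= G.
Variable U : (nat -> Prop) -> Prop.
Hypothesis FU : ProperFilter U.
Hypothesis U_free : forall P, Hierarchy.eventually P -> U P.
Hypothesis U_ultra : forall P : nat -> Prop, U P \/ U (fun n => ~ P n).

Definition shot (n : nat) (b : R) : R := fst (euler N c g (mesh n) b (node n 1)).

Lemma shot_limit (b : nat -> R) (A B : R) : U (fun n => A <= b n <= B) ->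
  exists (a : R) (v y : R -> R), A <= a <= B /\ ivp_solution N c g a v y /\
    filterlim (fun n => shot n (b n)) U (locally (v 1)).
Proof.
intros Hb. destruct (g_bounded B) as [G HG].
destruct (euler_limit N c g HN Hc g_ge0 U FU U_free U_ultra b A B G Hb HG)
  as [a [v [y [Ha [Hs Hl]]]]].
exists a, v, y. split; [exact Ha|split; [exact Hs|exact (Hl 1)]].
Qed.

(* The sign of the scheme's endpoint is read off the limit: the opposite sign along the
   ultrafilter would produce a solution contradicting the hypothesis. *)
Lemma shot_pos b : (forall v y, ivp_solution N c g b v y -> 0 < v 1) -> U (fun n => 0 < shot n b).
Proof.
intros H. destruct (U_ultra (fun n => 0 < shot n b)) as [h|h]; [exact h|exfalso].
destruct (shot_limit (fun _ => b) b b) as [a [v [y [Ha [Hs Hl]]]]].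
{ apply filter_forall. intros; lra. }
replace a with b in Hs by lra. specialize (H v y Hs).
assert (v 1 <= 0); [|lra].
refine (filterlim_R_le U FU _ _ _ _ _ Hl (filterlim_const 0)).
revert h. apply filter_imp. intros n Hn. lra.
Qed.

Lemma shot_neg b : (forall v y, ivp_solution N c g b v y -> v 1 < 0) -> U (fun n => shot n b < 0).
Proof.
intros H. destruct (U_ultra (fun n => shot n b < 0)) as [h|h]; [exact h|exfalso].
destruct (shot_limit (fun _ => b) b b) as [a [v [y [Ha [Hs Hl]]]]].
{ apply filter_forall. intros; lra. }
replace a with b in Hs by lra. specialize (H v y Hs).
assert (0 <= v 1); [|lra].
refine (filterlim_R_le U FU _ _ _ _ _ (filterlim_const 0) Hl).
revert h. apply filter_imp. intros n Hn. lra.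
Qed.

(** The zeros of the scheme lie in [[A, B]], so along [U] they converge to an initial value [a], and
    the solution obtained in the limit has endpoint [lim shot n (b n) = 0]. *)
Lemma shot_zero A B : U (fun n => exists b, A <= b <= B /\ shot n b = 0) ->
  exists (a : R) (v y : R -> R), A <= a <= B /\ ivp_solution N c g a v y /\ v 1 = 0.
Proof.
intros H.
(* Where no zero exists [epsilon] returns an arbitrary real; such [n] lie outside a set of [U]. *)
set (b := fun n => epsilon (inhabits 0) (fun b => A <= b <= B /\ shot n b = 0)).
assert (Hb : U (fun n => A <= b n <= B /\ shot n (b n) = 0)).
{ revert H. apply filter_imp. intros n Hn. exact (epsilon_spec (inhabits 0) _ Hn). }
destruct (shot_limit b A B) as [a [v [y [Ha [Hs Hl]]]]].
{ revert Hb. apply filter_imp. tauto. }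
exists a, v, y. split; [exact Ha|split; [exact Hs|]].
apply Rle_antisym.
- refine (filterlim_R_le U FU _ _ _ _ _ Hl (filterlim_const 0)).
  revert Hb. apply filter_imp. intros n Hn. lra.
- refine (filterlim_R_le U FU _ _ _ _ _ (filterlim_const 0) Hl).
  revert Hb. apply filter_imp. intros n Hn. lra.
Qed.

Lemma continuity_shot n : continuity (shot n).
Proof. apply (continuity_euler N c g HN g_cont). Qed.

(** The value [B] is excluded because its solutions end above [0]. With [shooting_down] this places
    the two initial values strictly on either side of [1], hence makes the two solutions
    distinct. *)
Lemma shooting_up A B : A < B ->
  (forall v y, ivp_solution N c g A v y -> v 1 < 0) ->
  (forall v y, ivp_solution N c g B v y -> 0 < v 1) ->
  exists (a : R) (v y : R -> R), A <= a < B /\ ivp_solution N c g a v y /\ v 1 = 0.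
Proof.
intros HAB HA HB. destruct (shot_zero A B) as [a [v [y [Ha [Hs Hv]]]]].
- generalize (filter_and _ _ (shot_neg A HA) (shot_pos B HB)). apply filter_imp.
  intros n [H1 H2]. destruct (IVT (shot n) A B (continuity_shot n) HAB H1 H2) as [z Hz].
  now exists z.
- exists a, v, y. split; [|now split].
  destruct (Req_dec a B) as [->|]; [|lra]. specialize (HB v y Hs). lra.
Qed.

Lemma shooting_down A B : A < B ->
  (forall v y, ivp_solution N c g A v y -> 0 < v 1) ->
  (forall v y, ivp_solution N c g B v y -> v 1 < 0) ->
  exists (a : R) (v y : R -> R), A < a <= B /\ ivp_solution N c g a v y /\ v 1 = 0.
Proof.
intros HAB HA HB. destruct (shot_zero A B) as [a [v [y [Ha [Hs Hv]]]]].
- generalize (filter_and _ _ (shot_pos A HA) (shot_neg B HB)). apply filter_imp.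
  intros n [H1 H2].
  destruct (IVT (- shot n)%F A B (continuity_opp _ (continuity_shot n)) HAB) as [z [Hz Hz']];
    unfold opp_fct in *; try lra.
  exists z. split; [exact Hz|lra].
- exists a, v, y. split; [|now split].
  destruct (Req_dec a A) as [->|]; [|lra]. specialize (HA v y Hs). lra.
Qed.

End Shooting.

(** * Two solutions of the positive problem for small [c] *)

Lemma two_radial_solutions (N : nat) (g : R -> R) : (1 <= N)%nat -> continuity g ->
  (forall s, 0 < s -> 0 < g s) ->
  (forall M, exists d, 0 < d /\ forall s, 0 < s < d -> M * s ^ N <= g s) ->
  (forall M, exists K, forall s, 0 < s -> K < s -> M * s ^ N <= g s) ->
  exists c0, 0 < c0 /\ forall c, 0 < c < c0 ->
    exists u1 u2, radial_solution N c g u1 /\ radial_solution N c g u2 /\ u1 0 <> u2 0.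
Proof.
intros HN Cg gp Hzero Hinf.
(* [gt] is bounded on half-lines and agrees with [g] along solutions positive on (0,1). *)
set (gt := fun s => g (Rmax s 0)).
assert (g00 : 0 <= g 0).
{ destruct (Rle_lt_dec 0 (g 0)) as [h|h]; [exact h|].
  destruct (proj1 (continuity_pt_eps g 0) (Cg 0) (- g 0) ltac:(lra)) as [d [Hd H]].
  specialize (H (d / 2)). rewrite Rminus_0_r, Rabs_right in H by lra. specialize (H ltac:(lra)).
  apply Rabs_def2 in H. specialize (gp (d / 2) ltac:(lra)). lra. }
assert (Egt : forall s, 0 < s -> gt s = g s) by (intros s Hs; unfold gt; rewrite Rmax_left; lra).
assert (Cgt : continuity gt) by exact (continuity_comp _ _ continuity_Rmax0 Cg).
assert (gt0 : forall s, 0 <= gt s).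
{ intros s. unfold gt. destruct (Rmax_r s 0) as [h|h]; [left; now apply gp|now rewrite <- h]. }
assert (gtp : forall s, 0 < s -> 0 < gt s) by (intros s Hs; rewrite Egt; auto).
assert (gtb : forall B, exists G, forall x, x <= B -> gt x <= G).
{ intros B. destruct (continuity_ab_maj g 0 (Rmax B 0) (Rmax_r B 0)) as [m [Hm _]].
  - intros; apply Cg.
  - exists (g m). intros x Hx. apply Hm. split; [apply Rmax_r|now apply Rle_max_compat_r]. }
(* [1 + 1] is the range [a + 1] of [ivp_v1_lower] at [a = 1]. The threshold [/ root N G] then makes
   [1 - c * root N G] positive. *)
destruct (gtb (1 + 1)) as [G HG].
assert (HG0 : 0 < G) by (apply Rlt_le_trans with (gt 1); [apply gtp|apply HG]; lra).
exists (/ root N G). split; [apply Rinv_0_lt_compat, root_pos, HG0|].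
intros c [Hc Hc'].
destruct ex_free_ultrafilter as [U [FU [U_free U_ultra]]].
assert (H1 : forall v y, ivp_solution N c gt 1 v y -> 0 < v 1).
{ intros v y Hs. pose proof (ivp_v1_lower N c gt HN Hc gt0 1 v y Hs G HG).
  pose proof (root_pos N G HG0).
  assert (H2 : c * root N G < / root N G * root N G) by (apply Rmult_lt_compat_r; lra).
  rewrite Rinv_l in H2 by lra. lra. }
set (M := (64 / c) ^ N).
assert (Hneg : forall b, 0 < b -> (forall x, b / 4 <= x <= 2 * b -> M * x ^ N <= g x) ->
  forall v y, ivp_solution N c gt b v y -> v 1 < 0).
{ intros b Hb Hg v y Hs. destruct (gtb (2 * b)) as [Gb HGb].
  apply (ivp_v1_neg N c gt HN Hc b v y Hs Gb Hb HGb).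
  intros x Hx. rewrite Egt by lra. now apply Hg. }
assert (Hconv : forall a v y, 0 < a -> ivp_solution N c gt a v y -> v 1 = 0 ->
  exists u, radial_solution N c g u /\ u 0 = a).
{ intros a v y Ha Hs Hv.
  destruct (ivp_radial_solution N c gt a v y HN Hc Cgt gt0 gtp Ha Hs Hv)
    as [u [[w [d [K1 [K2 [K3 [K4 [K5 [K6 [K7 K8]]]]]]]]] Hu0]].
  exists u. split; [|exact Hu0]. exists w, d. repeat (split; [assumption|]).
  split; [|repeat (split; [assumption|]); assumption].
  intros r Hr. rewrite <- Egt by now apply K7. now apply K4. }
destruct (Hzero M) as [d [Hd Hd']]. destruct (Hinf M) as [K HK].
(* The interval [[A / 4, 2 * A]] lies in [(0, d)], and [A < 1]. *)
set (A := Rmin (d / 3) (1 / 2)).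
assert (HA : 0 < A) by (apply Rmin_pos; lra).
assert (HA1 : A <= d / 3) by apply Rmin_l. assert (HA2 : A <= 1 / 2) by apply Rmin_r.
(* Every [x >= B / 4] exceeds [K]: by [5 * K / 4] if [K > 0], and by [1 / 2] otherwise. Also
   [B > 1]. *)
set (B := Rmax (5 * K) 2).
assert (HB1 : 5 * K <= B) by apply Rmax_l. assert (HB2 : 2 <= B) by apply Rmax_r.
destruct (shooting_up N c gt HN Hc Cgt gt0 gtb U FU U_free U_ultra A 1 ltac:(lra))
  as [a1 [v1 [y1 [Ha1 [Hs1 Hv1]]]]]; [|exact H1|].
{ apply Hneg; [exact HA|]. intros x Hx. apply Hd'. lra. }
destruct (shooting_down N c gt HN Hc Cgt gt0 gtb U FU U_free U_ultra 1 B ltac:(lra) H1)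
  as [a2 [v2 [y2 [Ha2 [Hs2 Hv2]]]]].
{ apply Hneg; [lra|]. intros x Hx. apply HK; lra. }
destruct (Hconv a1 v1 y1 ltac:(lra) Hs1 Hv1) as [u1 [Hu1 E1]].
destruct (Hconv a2 v2 y2 ltac:(lra) Hs2 Hv2) as [u2 [Hu2 E2]].
exists u1, u2. split; [exact Hu1|split; [exact Hu2|lra]].
Qed.

(** * Signs, and the return to (MO) *)

Lemma pow_opp_sign (x : R) N : (- x) ^ N = (-1) ^ N * x ^ N.
Proof. rewrite <- Rpow_mult_distr. f_equal. ring. Qed.

Lemma sign_sqr N : (-1) ^ N * (-1) ^ N = 1.
Proof. rewrite <- Rpow_mult_distr. replace (-1 * -1) with 1 by ring. apply pow1. Qed.

(** As [u' = - w], the power [(u')^N] contributes a factor [(-1)^N], which cancels the one in the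
    nonlinearity. *)
Lemma radial_solution_MO_pos N c f u :
  radial_solution N c (fun s => (-1) ^ N * f (- s)) u -> MO_solution N f c u.
Proof.
intros [w [d [K1 [K2 [K3 [K4 [K5 [K6 _]]]]]]]].
exists (fun x => - w x), (fun x => - d x).
split; [exact K1|split; [|split; [|split; [|split]]]].
- intros x. now apply derivable_pt_lim_opp.
- now apply continuity_opp.
- intros r Hr. specialize (K4 r Hr). apply is_derive_Reals.
  apply (is_derive_ext (fun t => (-1) ^ N * w t ^ N)).
  { intros t. symmetry. apply pow_opp_sign. }
  apply is_derive_Reals.
  replace (c ^ N * INR N * r ^ (N - 1) * f (- u r)) with
    ((-1) ^ N * (c ^ N * INR N * r ^ (N - 1) * ((-1) ^ N * f (- u r)))).
  + now apply (derivable_pt_lim_scal (fun t => w t ^ N)).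
  + transitivity ((-1) ^ N * (-1) ^ N * (c ^ N * INR N * r ^ (N - 1) * f (- u r))); [ring|].
    rewrite sign_sqr. ring.
- rewrite K5. ring.
- exact K6.
Qed.

Lemma radial_solution_MO_neg N c f u :
  radial_solution N c f u -> MO_solution N f c (fun x => - u x).
Proof.
intros [w [d [K1 [K2 [K3 [K4 [K5 [K6 _]]]]]]]].
exists w, d.
split; [|split; [exact K2|split; [exact K3|split; [|split; [exact K5|lra]]]]].
- intros x. rewrite <- (Ropp_involutive (w x)). now apply derivable_pt_lim_opp.
- intros r Hr. rewrite Ropp_involutive. now apply K4.
Qed.

Theorem theorem4p9 (N : nat) (f : R -> R) :
  (1 <= N)%nat ->
  cond_f1 N f -> f0_is_infty N f -> finf_is_infty N f ->
  (exists lamp : R, lamp > 0 /\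
     forall lam, 0 < lam < lamp ->
       exists u1 u2 : R -> R,
         MO_solution N f lam u1 /\ MO_solution N f lam u2 /\
         (exists r, 0 <= r <= 1 /\ u1 r <> u2 r) /\
         (forall r, 0 < r < 1 -> u1 r > 0) /\
         (forall r, 0 < r < 1 -> u2 r > 0) /\
         strictly_concave_on_01 u1 /\ strictly_concave_on_01 u2) /\
  (exists lamm : R, lamm > 0 /\
     forall lam, 0 < lam < lamm ->
       exists u1 u2 : R -> R,
         MO_solution N f lam u1 /\ MO_solution N f lam u2 /\
         (exists r, 0 <= r <= 1 /\ u1 r <> u2 r) /\
         (forall r, 0 < r < 1 -> u1 r < 0) /\
         (forall r, 0 < r < 1 -> u2 r < 0) /\
         strictly_convex_on_01 u1 /\ strictly_convex_on_01 u2).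
Proof.
intros HN [Cf Hf] H0 Hinf.
assert (Hquot : forall s M, s <> 0 -> f s / s ^ N > M -> 0 < s ^ N -> M * s ^ N <= f s).
{ intros s M Hs H Hp. apply Rlt_le. apply (Rmult_lt_reg_r (/ s ^ N)); [now apply Rinv_0_lt_compat|].
  rewrite Rmult_assoc, Rinv_r, Rmult_1_r by lra. exact H. }
(* Since [(-1)^N] is its own inverse, the quotient of [f] at [- s] equals that of [(-1)^N * f (- s)]
   by [s ^ N]; the limits on the negative side thus become growth of the reflected nonlinearity. *)
assert (Hquot' : forall s M, 0 < s -> f (- s) / (- s) ^ N > M -> M * s ^ N <= (-1) ^ N * f (- s)).
{ intros s M Hs H. pose proof (pow_lt s N Hs) as Hp.
  assert (E : f (- s) / (- s) ^ N = (-1) ^ N * f (- s) / s ^ N).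
  { rewrite pow_opp_sign. apply (Rmult_eq_reg_l ((-1) ^ N * (-1) ^ N)); [|rewrite sign_sqr; lra].
    rewrite sign_sqr at 2. field. split; [lra|]. apply pow_nonzero. lra. }
  rewrite E in H. apply Rlt_le. apply (Rmult_lt_reg_r (/ s ^ N)); [now apply Rinv_0_lt_compat|].
  rewrite Rmult_assoc, Rinv_r, Rmult_1_r by lra. exact H. }
split.
- destruct (two_radial_solutions N (fun s => (-1) ^ N * f (- s)) HN) as [c0 [Hc0 H]].
  + apply (continuity_scal (fun s => f (- s))).
    apply (continuity_comp Ropp f); [|exact Cf].
    apply continuity_opp, derivable_continuous, derivable_id.
  + intros s Hs. specialize (Hf (- s) ltac:(lra)). rewrite pow_opp_sign in Hf.
    pose proof (pow_lt s N Hs). apply (Rmult_lt_reg_r (s ^ N)); lra.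
  + intros M. destruct (H0 M) as [d [Hd Hd']]. exists d. split; [exact Hd|]. intros s Hs.
    apply Hquot'; [lra|]. apply Hd'; [lra|]. rewrite Rabs_Ropp, Rabs_right; lra.
  + intros M. destruct (Hinf M) as [K HK]. exists K. intros s Hs HsK.
    apply Hquot'; [lra|]. apply HK. rewrite Rabs_Ropp, Rabs_right; lra.
  + exists c0. split; [exact Hc0|]. intros lam Hlam.
    destruct (H lam Hlam) as [u1 [u2 [Hu1 [Hu2 Hne]]]]. exists u1, u2.
    split; [now apply radial_solution_MO_pos|split; [now apply radial_solution_MO_pos|]].
    destruct Hu1 as [w1 [d1 [_ [_ [_ [_ [_ [_ [P1 C1]]]]]]]]].
    destruct Hu2 as [w2 [d2 [_ [_ [_ [_ [_ [_ [P2 C2]]]]]]]]].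
    (* The solutions differ at [0], where their values are the two shooting parameters. *)
    split; [exists 0; split; [lra|exact Hne]|]. now repeat split.
- destruct (two_radial_solutions N f HN Cf) as [c0 [Hc0 H]].
  + intros s Hs. specialize (Hf s ltac:(lra)).
    pose proof (pow_lt s N Hs). apply (Rmult_lt_reg_r (s ^ N)); lra.
  + intros M. destruct (H0 M) as [d [Hd Hd']]. exists d. split; [exact Hd|]. intros s Hs.
    apply Hquot; [lra| |apply pow_lt; lra]. apply Hd'; [lra|]. rewrite Rabs_right; lra.
  + intros M. destruct (Hinf M) as [K HK]. exists K. intros s Hs HsK.
    apply Hquot; [lra| |apply pow_lt; lra]. apply HK. rewrite Rabs_right; lra.
  + exists c0. split; [exact Hc0|]. intros lam Hlam.
    destruct (H lam Hlam) as [u1 [u2 [Hu1 [Hu2 Hne]]]].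
    exists (fun x => - u1 x), (fun x => - u2 x).
    split; [now apply radial_solution_MO_neg|split; [now apply radial_solution_MO_neg|]].
    destruct Hu1 as [w1 [d1 [_ [_ [_ [_ [_ [_ [P1 C1]]]]]]]]].
    destruct Hu2 as [w2 [d2 [_ [_ [_ [_ [_ [_ [P2 C2]]]]]]]]].
    split; [exists 0; split; [lra|lra]|].
    split; [intros r Hr; specialize (P1 r Hr); lra|].
    split; [intros r Hr; specialize (P2 r Hr); lra|].
    split; intros x y t Hx Hy Hxy Ht.
    * specialize (C1 x y t Hx Hy Hxy Ht). lra.
    * specialize (C2 x y t Hx Hy Hxy Ht). lra.
Qed.
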